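(* Let $d\ge2$ and let $p\in(0,1)$ with $p>p_c(d)$. Then, for $\mathbb{P}_p$-almost every $\omega$, every bounded harmonic function on $\mathcal{C}_\infty(\omega)$ is zero.
   Context: Let $E_d$ be the set of (undirected, nearest neighbor) edges of $\mathbb{Z}^d$. Bernoulli bond percolation with parameter $p\in(0,1)$ is the product probability measure $\mathbb{P}_p$ on $\{0,1\}^{E_d}$ under which every edge $e$ independently satisfies $\omega(e)=1$ (kept) with probability $p$ and $\omega(e)=0$ (deleted) with probability $1-p$. Each $\omega$ is identified with the subgraph of the lattice consisting of the kept edges. There is a critical parameter $p_c(d)\in(0,1)$ such that for $p>p_c(d)$ there is $\mathbb{P}_p$-almost surely a unique infinite connected component (cluster) $\mathcal{C}_\infty(\omega)$ of this subgraph, and for $p<p_c(d)$ there are almost surely only finite clusters. For $x\in\mathcal{C}_\infty(\omega)$ let $c_\omega(x)=\#\{(x,y)\in E_d\mid\omega((x,y))=0\}$ be the number of deleted lattice edges at $x$, and let $b_\omega(x,y)=1$ if $x,y\in\mathcal{C}_\infty(\omega)$ are joined by a kept edge, and $b_\omega(x,y)=0$ otherwise. The Laplacian with Dirichlet boundary conditions is $$\Delta_\omega u(x)=\sum_{y\in\mathcal{C}_\infty(\omega)}b_\omega(x,y)(u(x)-u(y))+c_\omega(x)u(x),\qquad x\in\mathcal{C}_\infty(\omega).$$ A function $u$ is called harmonic on $\mathcal{C}_\infty(\omega)$ if $u$ vanishes outside $\mathcal{C}_\infty(\omega)$ and $\Delta_\omega u=0$ on $\mathcal{C}_\infty(\omega)$.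 *)

(* Defs.v *)
From HB Require Import structures.
From mathcomp Require Import all_boot all_order all_algebra finmap.
From mathcomp Require Import all_classical all_reals all_analysis.

Set Implicit Arguments.
Unset Strict Implicit.
Unset Printing Implicit Defensive.

Import Order.TTheory GRing.Theory Num.Theory.
Import numFieldNormedType.Exports.
Local Open Scope classical_set_scope.
Local Open Scope ring_scope.

Definition lattice (d : nat) := 'rV[int]_d.

HB.instance Definition _ (d : nat) := Countable.on (lattice d).

Definition nearest_neighbors (d : nat) (x y : lattice d) : Prop :=
  \sum_(i < d) `|x 0 i - y 0 i| = 1.

(* An undirected edge is the unordered pair of its end points. *)
Definition edge (d : nat) :=
  {e : {fset lattice d} |
     `[< exists x y, nearest_neighbors x y /\ e = [fset x; y]%fset >]}.

HB.instance Definition _ (d : nat) := SubCountable.on (edge d).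

(* {0,1}^E, with true for a kept edge, equipped with the product
   sigma-algebra, i.e. the one generated by the coordinate events. *)
Definition coordinate_events (d : nat) : set (set (edge d -> bool)) :=
  [set A | exists (e : edge d) (b : bool), A = [set w | w e = b]].

Definition config (d : nat) := g_sigma_algebraType (@coordinate_events d).

(* P is the product of the Bernoulli(p) measures on {0,1}^E: it has the product
   value on every finite-dimensional cylinder. These cylinders form a
   pi-system generating the sigma-algebra, so P is determined by p. *)
Definition bernoulli_percolation (R : realType) (d : nat) (p : R)
    (P : probability (config d) R) : Prop :=
  forall (F : {fset edge d}) (v : edge d -> bool),
    P [set w : config d | forall e, e \in F -> w e = v e] =
    (\prod_(e <- F) (if v e then p else 1 - p))%:E.

Definition kept_edge (d : nat) (w : config d) (x y : lattice d) : Prop :=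
  exists e : edge d, val e = [fset x; y]%fset /\ w e = true.

Definition kept_cluster (d : nat) (w : config d) (x : lattice d) : set (lattice d) :=
  [set y | exists s : seq (lattice d),
     path (fun a b => `[< kept_edge w a b >]) x s /\ last x s = y].

(* The set of vertices lying in an infinite cluster. Whenever there is exactly
   one infinite cluster, as is almost surely the case above p_c, this set is
   that cluster. *)
Definition infinite_cluster (d : nat) (w : config d) : set (lattice d) :=
  [set x | infinite_set (kept_cluster w x)].

(* The supremum of the parameters for which a.s. all clusters are finite; the
   set contains 0 and is bounded by 1. *)
Definition critical_parameter (R : realType) (d : nat) : R :=
  sup [set q : R | 0 <= q <= 1 /\
    exists P : probability (config d) R, bernoulli_percolation q P /\
      {ae P, forall w, forall x, finite_set (kept_cluster w x)}].

Definition deleted_degree (d : nat) (w : config d) (x : lattice d) : nat :=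
  #|` fset_set [set e : edge d | x \in val e /\ w e = false] |.

Definition edge_weight (R : realType) (d : nat) (w : config d)
    (x y : lattice d) : R :=
  (`[< infinite_cluster w x /\ infinite_cluster w y /\ kept_edge w x y >])%:R.

(* The sum over the infinite cluster has finite support, since the weight
   vanishes unless y is one of the 2d lattice neighbors of x. *)
Definition laplacian (R : realType) (d : nat) (w : config d)
    (u : lattice d -> R) (x : lattice d) : R :=
  \sum_(y \in infinite_cluster w) edge_weight R w x y * (u x - u y)
  + (deleted_degree w x)%:R * u x.

Definition cluster_harmonic (R : realType) (d : nat) (w : config d)
    (u : lattice d -> R) : Prop :=
  (forall x, ~ infinite_cluster w x -> u x = 0) /\
  (forall x, infinite_cluster w x -> laplacian w u x = 0).

(* Main.v *)
Require Import Defs.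
From mathcomp Require Import all_boot all_order all_algebra finmap.
From mathcomp Require Import zify ring lra.
From mathcomp Require Import all_classical all_reals all_analysis measurable_realfun.
Import Order.TTheory GRing.Theory Num.Theory.
Import numFieldNormedType.Exports.
Local Open Scope classical_set_scope.
Local Open Scope ring_scope.

(* Each vertex has 2d edges, kept or deleted, so harmonicity says that 2d u(x)
   is the sum of u over the neighbors joined to x by kept edges. Hence |u(x)| is
   at most sup |u| times the probability S_n(w, x) that n steps of the simple
   random walk on Z^d started at x use only kept edges. After averaging over w,
   a walk through k distinct edges survives with probability at most p^k. From
   any point the walk goes straight for k steps with probability (2d)^-k, so if
   c bounds E S_n(x) for all x then E S_(n+k)(x) is at most
   (1 - (2d)^-k) c + (2d)^-k p^k. Iterating, E S_n(x) tends to 0 uniformly in x,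
   and S_n is nonincreasing in n, so almost surely inf_n S_n(x) = 0 for all x. *)

(** * The 2d lattice directions and the edges at a vertex *)

Definition direction (d : nat) := ('I_d * bool)%type.

Lemma direction_gt0 d : (0 < d)%N -> (0 < #|{: direction d}|)%N.
Proof. by move=> d0; rewrite card_prod card_ord card_bool muln_gt0 d0. Qed.

Definition unit_vector (d : nat) (i : direction d) : 'rV[int]_d :=
  (-1) ^+ i.2 *: delta_mx 0 i.1.

Definition neighbor (d : nat) (x : lattice d) (i : direction d) : lattice d :=
  (x : 'rV_d) + unit_vector d i.

Lemma unit_vectorE d (i : direction d) k :
  unit_vector d i 0 k = (-1) ^+ i.2 * (i.1 == k)%:R.
Proof. by rewrite !mxE eqxx /= eq_sym. Qed.

Lemma unit_vector_inj d : injective (unit_vector d).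
Proof.
move=> [i b] [j c] /matrixP /(_ 0) E.
have := E i; rewrite !unit_vectorE /= eqxx.
case: eqVneq => [->|_]; last by case: (b); rewrite mulr0.
by case: b {E}; case: c.
Qed.

Lemma neighbor_inj d (x : lattice d) : injective (neighbor d x).
Proof. by move=> i j /addrI /unit_vector_inj. Qed.

(** Nonnegative integers with sum 1 are all 0 except for a single 1, so exactly one coordinate
    changes, and it changes by 1. *)
Lemma nearest_neighborsP d (x y : lattice d) :
  nearest_neighbors x y <-> exists i, y = neighbor d x i.
Proof.
rewrite /nearest_neighbors; split.
- move=> E.
  have [i zi] : exists i, x 0 i - y 0 i != 0.
    apply/existsP; apply: contraTT isT => /existsPn z.
    move: E; rewrite big1 // => i _.
    by have := z i; rewrite negbK => /eqP ->; rewrite normr0.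
  move: E; rewrite (bigD1 i) //= => E.
  have S0 : 0 <= \sum_(j < d | j != i) `|x 0 j - y 0 j|.
    by apply: sumr_ge0 => j _.
  have zi1 : 1 <= `|x 0 i - y 0 i| by rewrite -gtz0_ge1 normr_gt0.
  have S1 : \sum_(j < d | j != i) `|x 0 j - y 0 j| = 0.
    by apply/le_anti; rewrite S0 andbT -(lerD2l 1) addr0 -{2}E lerD2r.
  have xy j : j != i -> x 0 j = y 0 j.
    move=> ji; apply/eqP; rewrite -subr_eq0 -normr_eq0; apply/eqP.
    by move/eqP: S1; rewrite psumr_eq0 // => /allP /(_ j); rewrite mem_index_enum ji => /(_ isT) /eqP.
  (* The Boolean is the sign bit: [true] when coordinate [i] decreases from [x] to [y]. *)
  exists (i, y 0 i < x 0 i); apply/rowP => j.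
  rewrite mxE unit_vectorE /=; case: eqVneq => [<-|ij].
    move: E; rewrite S1 addr0 mulr1; case: ltP => h /=; rewrite ?expr0 ?expr1.
      rewrite gtr0_norm ?subr_gt0 // => E.
      lia.
    rewrite ler0_norm ?subr_le0 // => E.
    lia.
  by rewrite mulr0 addr0 xy // eq_sym.
- move=> [i ->]; rewrite (bigD1 i.1) //= big1 => [|j ji].
    by rewrite mxE unit_vectorE eqxx mulr1 opprD addrA subrr sub0r addr0 normrN normrX normrN1 expr1n.
  by rewrite mxE unit_vectorE eq_sym (negPf ji) mulr0 addr0 subrr normr0.
Qed.

Lemma edge_at_subproof d (x : lattice d) (i : direction d) :
  `[< exists a b : lattice d, nearest_neighbors a b /\
      [fset x; neighbor d x i]%fset = [fset a; b]%fset >].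
Proof.
apply/asboolP; exists x, (neighbor d x i); split => //.
by apply/nearest_neighborsP; exists i.
Qed.

Definition edge_at d (x : lattice d) (i : direction d) : edge d :=
  exist _ [fset x; neighbor d x i]%fset (edge_at_subproof d x i).

Lemma neighbor_neq d (x : lattice d) i : neighbor d x i != x.
Proof.
apply/eqP => /(congr1 (fun z : 'rV[int]_d => z 0 i.1)).
by rewrite mxE unit_vectorE eqxx mulr1 -[RHS]addr0 => /addrI; case: i.2.
Qed.

Lemma edge_at_inj d (x : lattice d) : injective (edge_at d x).
Proof.
move=> i j /(congr1 val) /= /fsetP /(_ (neighbor d x i)).
by rewrite !inE eqxx orbT (negPf (neighbor_neq d x i)) /= => /esym /eqP /neighbor_inj.
Qed.

Lemma edge_atP d (x : lattice d) (e : edge d) :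
  x \in val e <-> exists i, e = edge_at d x i.
Proof.
split=> [xe|[i ->]]; last by rewrite !inE eqxx.
have /asboolP [a [b [ab E]]] := valP e.
have /nearest_neighborsP [i bE] := ab.
have /nearest_neighborsP [j aE] : nearest_neighbors b a.
  by apply: etrans ab; apply: eq_bigr => k _; rewrite distrC.
move: xe; rewrite E !inE => /orP [] /eqP ->.
  by exists i; apply: val_inj; rewrite /= E bE.
by exists j; apply: val_inj; rewrite /= E -aE fsetUC.
Qed.

Lemma kept_edgeP d (w : config d) (x y : lattice d) :
  kept_edge w x y <-> exists i, y = neighbor d x i /\ w (edge_at d x i).
Proof.
split=> [[e [E we]]|[i [-> wi]]]; last by exists (edge_at d x i).
have [i ei] : exists i, e = edge_at d x i by apply/edge_atP; rewrite E !inE eqxx.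
exists i; split; last by rewrite -ei we.
apply/eqP; move: E; rewrite ei /= => /fsetP E; rewrite eq_sym.
have := E (neighbor d x i); rewrite !inE eqxx orbT.
by rewrite (negPf (neighbor_neq d x i)) => /esym.
Qed.

(** * The Dirichlet Laplacian as a sum over directions *)

Lemma kept_edge_sym d (w : config d) (x y : lattice d) :
  kept_edge w x y -> kept_edge w y x.
Proof. by move=> [e [E we]]; exists e; rewrite fsetUC. Qed.

(** Putting the edge from [y] to [x] in front of a path from [x] embeds the cluster of [x] in that
    of [y]. *)
Lemma infinite_cluster_kept d (w : config d) (x y : lattice d) :
  kept_edge w x y -> infinite_cluster w x -> infinite_cluster w y.
Proof.
move=> xy; apply: contra_not; apply: sub_finite_set => z [s [ps <-]].
exists (x :: s); split => //=; rewrite ps andbT.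
exact/asboolP/kept_edge_sym.
Qed.

(** [fset_set] is meaningful only on finite sets, so the set of deleted edges is first rewritten as
    the finite image of the deleted directions. *)
Lemma deleted_degreeE d (w : config d) (x : lattice d) :
  deleted_degree w x = #|[pred i | ~~ w (edge_at d x i)]|.
Proof.
pose r := [seq edge_at d x i | i <- enum [pred i | ~~ w (edge_at d x i)]].
rewrite /deleted_degree (_ : [set e | _] = [set` [fset e in r]%fset]); last first.
  apply/seteqP; split=> e /=.
    move=> [/edge_atP [i ->]] wi; rewrite inE /=; apply/mapP; exists i => //.
    by rewrite mem_enum inE /= wi.
  rewrite inE /= => /mapP [i]; rewrite mem_enum inE => /negPf wi ->; split => //.
  by apply/edge_atP; exists i.
rewrite set_fsetK card_fseq undup_id ?size_map -?cardE //.
by rewrite map_inj_uniq ?enum_uniq //; exact: edge_at_inj.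
Qed.

(** A kept edge at [x] leads back into the infinite cluster, so its weight is just its state. Kept
    and deleted edges together contribute the full degree 2d to the coefficient of [u x]. *)
Lemma laplacianE (R : realType) d (w : config d) (u : lattice d -> R) x :
  infinite_cluster w x ->
  laplacian w u x = #|{: direction d}|%:R * u x
    - \sum_i (w (edge_at d x i))%:R * u (neighbor d x i).
Proof.
move=> Cx; rewrite /laplacian deleted_degreeE.
rewrite (fsbig_widen _ setT) //; last first.
  move=> y [_ /= Cy]; rewrite /edge_weight.
  by rewrite asboolF ?mul0r // => -[_ []].
rewrite (@fsbigE _ _ _ _ _ [seq neighbor d x i | i <- index_enum (direction d)]); first last.
- move=> y _ yr; rewrite /edge_weight asboolF ?mul0r // => -[_ [_ /kept_edgeP [i [yi _]]]].
  by move/negP: yr; apply; rewrite yi map_f ?mem_index_enum.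
- by [].
- by rewrite map_inj_uniq ?index_enum_uniq //; exact: neighbor_inj.
rewrite big_map (eq_bigl xpredT) => [|i]; last by rewrite in_setT.
have kept i : edge_weight R w x (neighbor d x i) = (w (edge_at d x i))%:R.
  congr ((nat_of_bool _)%:R); apply/asboolP/idP => [[_ [_ /kept_edgeP [j [/neighbor_inj ->]]]] //|wi].
  have k : kept_edge w x (neighbor d x i) by apply/kept_edgeP; exists i.
  by split => //; split => //; exact: infinite_cluster_kept k Cx.
under eq_bigr do rewrite kept mulrBr.
rewrite sumrB -mulr_suml addrAC -mulrDl; congr (_ * _ - _).
rewrite -natr_sum -natrD -(cardC [pred i | w (edge_at d x i)]); congr (_ + _)%:R.
rewrite -sum1_card [RHS]big_mkcond.
by apply: eq_bigr => i _; rewrite inE; case: (w _).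
Qed.

(** The bound also holds off the infinite cluster, where [u] vanishes; it can thus be iterated
    without tracking whether the walk is in the cluster. *)
Lemma harmonic_average (R : realType) d (w : config d) (u : lattice d -> R) x :
  (0 < d)%N -> cluster_harmonic w u ->
  `|u x| <= #|{: direction d}|%:R^-1 *
    \sum_i (w (edge_at d x i))%:R * `|u (neighbor d x i)|.
Proof.
move=> d0 [uout uharm].
have N0 : 0 < #|{: direction d}|%:R :> R.
  by rewrite ltr0n direction_gt0.
have [Cx|/uout ->] := pselect (infinite_cluster w x); last first.
  rewrite normr0; apply: mulr_ge0; first by rewrite invr_ge0 ltW.
  by apply: sumr_ge0 => i _; exact: mulr_ge0.
rewrite ler_pdivlMl // -[X in X * _](gtr0_norm N0) -normrM.
move: (uharm x Cx); rewrite (laplacianE _ _ _ _ _ Cx) => /subr0_eq ->.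
apply: le_trans (ler_norm_sum _ _ _) _; apply: ler_sum => i _.
by rewrite normrM ger0_norm.
Qed.

(** * The survival probability S_n(w, x), by conditioning on the first step *)

Fixpoint survival (R : realType) d n (w : config d) (x : lattice d) : R :=
  if n is m.+1 then
    #|{: direction d}|%:R^-1 *
      \sum_i (w (edge_at d x i))%:R * survival R d m w (neighbor d x i)
  else 1.

Lemma survivalS (R : realType) d n (w : config d) (x : lattice d) :
  survival R d n.+1 w x = #|{: direction d}|%:R^-1 *
    \sum_i (w (edge_at d x i))%:R * survival R d n w (neighbor d x i).
Proof. by []. Qed.

Lemma survival_ge0 (R : realType) d n (w : config d) (x : lattice d) :
  0 <= survival R d n w x.
Proof.
elim: n x => [|n IH] x //=; apply: mulr_ge0; first by rewrite invr_ge0.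
by apply: sumr_ge0 => i _; exact: mulr_ge0.
Qed.

Lemma survival_succ (R : realType) d n (w : config d) (x : lattice d) :
  survival R d n.+1 w x <= survival R d n w x.
Proof.
elim: n x => [|n IH] x.
  (* For d = 0 there are no directions, and the convention that 0 has inverse 0 makes the left side
     0. *)
  rewrite /=; have [->|N0] := eqVneq #|{: direction d}|%:R (0 : R).
    by rewrite invr0 mul0r.
  rewrite ler_pdivrMl ?lt0r ?N0 ?ler0n // mulr1 -sum1_card natr_sum.
  by apply: ler_sum => i _; rewrite mulr1; case: (w _).
rewrite [leLHS]survivalS [leRHS]survivalS; apply: ler_wpM2l; first by rewrite invr_ge0.
by apply: ler_sum => i _; apply: ler_wpM2l.
Qed.

Lemma survival_nonincreasing (R : realType) d n k (w : config d) (x : lattice d) :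
  survival R d (n + k) w x <= survival R d n w x.
Proof.
elim: k => [|k IH]; first by rewrite addn0.
by rewrite addnS; exact: le_trans (survival_succ _ _ _ _ _) IH.
Qed.

Lemma measurable_kept (R : realType) d (e : edge d) :
  measurable_fun setT (fun w : config d => (w e)%:R : R).
Proof.
have m : measurable ([set w | w e = true] : set (config d)).
  by apply: sub_sigma_algebra; exists e, true.
rewrite (_ : (fun w => _) = \1_([set w : config d | w e = true])); last first.
  apply/funext => w; rewrite indicE; congr (nat_of_bool _)%:R.
  by apply/idP/idP; rewrite inE.
exact: measurable_indic.
Qed.

Lemma measurable_survival (R : realType) d n (x : lattice d) :
  measurable_fun setT (fun w : config d => survival R d n w x).
Proof.
elim: n x => [|n IH] x /=; first exact: measurable_cst.
apply: measurable_funM; first exact: measurable_cst.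
by apply: measurable_sum => i; apply: measurable_funM; [exact: measurable_kept|].
Qed.

Lemma harmonic_le_survival (R : realType) d (w : config d) (u : lattice d -> R) M :
  (0 < d)%N -> cluster_harmonic w u -> (forall x, `|u x| <= M) ->
  forall n x, `|u x| <= M * survival R d n w x.
Proof.
move=> d0 uh uM; elim=> [|n IH] x; first by rewrite mulr1.
apply: le_trans (harmonic_average _ _ _ _ _ d0 uh) _.
rewrite /= mulrCA; apply: ler_wpM2l; first by rewrite invr_ge0.
rewrite mulr_sumr; apply: ler_sum => i _.
by rewrite mulrCA; apply: ler_wpM2l.
Qed.

(** * Straight paths and their survival probability *)

Definition translate d (x : lattice d) (i : direction d) (j : nat) : lattice d :=
  (x : 'rV_d) + unit_vector d i *+ j.

Lemma translateS d x i j : translate d x i j.+1 = neighbor d (translate d x i j) i.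
Proof. by rewrite /neighbor /translate mulrSr addrA. Qed.

Lemma translate_inj d x i : injective (translate d x i).
Proof.
move=> j k /addrI /(congr1 (fun z : 'rV[int]_d => z 0 i.1)).
rewrite !mulmxnE unit_vectorE eqxx mulr1 -[LHS]mulr_natr -[RHS]mulr_natr.
move=> /mulfI; rewrite signr_eq0 => /(_ isT) /eqP.
by rewrite eqr_nat => /eqP.
Qed.

(** The edge number j joins the points j and j+1 of a line. If edges j and k agree, then j is k or
    k+1 and k is j or j+1, hence j = k. *)
Lemma edge_at_translate_inj d x i : injective (fun j => edge_at d (translate d x i j) i).
Proof.
move=> j k /(congr1 val) /= /fsetP E.
have := E (translate d x i j); have := E (translate d x i k).
rewrite -!translateS !inE !(inj_eq (@translate_inj d x i)); lia.
Qed.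

Definition straight (R : realType) d j (w : config d) (x : lattice d) i : R :=
  \prod_(l < j) (w (edge_at d (translate d x i l) i))%:R.

Lemma measurable_straight (R : realType) d j (x : lattice d) i :
  measurable_fun setT (fun w : config d => straight R d j w x i).
Proof. by apply: measurable_prod => l _; exact: measurable_kept. Qed.

Lemma straight_ge0 (R : realType) d j (w : config d) x i :
  0 <= straight R d j w x i.
Proof. by apply: prodr_ge0. Qed.

Lemma straight_le1 (R : realType) d j (w : config d) x i :
  straight R d j w x i <= 1.
Proof. by apply: prodr_ile1 => l _; case: (w _) => /=; rewrite ?ler01 ?lexx. Qed.

Lemma integral_straight (R : realType) d (p : R) (P : probability (config d) R)
    j (x : lattice d) i : bernoulli_percolation p P ->
  (\int[P]_w (straight R d j w x i)%:E = (p ^+ j)%:E)%E.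
Proof.
move=> hP.
pose F := [fset edge_at d (translate d x i (l : 'I_j)) i | l in 'I_j]%fset.
pose A := [set w : config d | forall e, e \in F -> w e = true].
(* The j edges are distinct, so the cylinder has probability exactly p^j. *)
have Fj : #|` F| = j.
  rewrite card_imfset /= -?cardE ?card_ord // => l k.
  by move=> /edge_at_translate_inj /val_inj.
have strE w : straight R d j w x i = \1_A w.
  rewrite indicE /straight; case: (boolP (w \in A)).
    rewrite inE => wA; rewrite big1 // => l _.
    by rewrite wA //; apply/imfsetP; exists l.
  rewrite notin_setE => /existsNP [e /not_implyP [/imfsetP [l /= _ ->] we]].
  by rewrite (bigD1 l) //=; move/negP/negPf: we => ->; rewrite mul0r.
have mA : measurable A.
  rewrite (_ : A = \bigcap_(e in [set` F]) [set w | w e = true]); last by [].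
  apply: fin_bigcap_measurable => // e _.
  by apply: sub_sigma_algebra; exists e, true.
under eq_integral do rewrite strE.
rewrite integral_indic // setIT.
apply: etrans (hP F (fun=> true)) _.
by rewrite big_const_seq count_predT -[size _]/(#|` F|) Fj iter_mulr_1.
Qed.

(* Induction on k: with probability 1/(2d) the next step extends the straight
   path; otherwise forget the path and use the bound c. *)
Lemma integral_straight_survival (R : realType) d (p : R)
    (P : probability (config d) R) (i0 : direction d) n (c : R) :
  bernoulli_percolation p P ->
  (forall x, \int[P]_w (survival R d n w x)%:E <= c%:E)%E ->
  forall k j x,
  (\int[P]_w (straight R d j w x i0 * survival R d (n + k) w (translate d x i0 j))%:E
   <= ((1 - #|{: direction d}|%:R^-1 ^+ k) * c +
       #|{: direction d}|%:R^-1 ^+ k * p ^+ (j + k))%:E)%E.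
Proof.
move=> hP Sc k; set q := #|{: direction d}|%:R^-1 : R.
have N0 : #|{: direction d}|%:R != 0 :> R.
  by rewrite pnatr_eq0 -lt0n; apply/card_gt0P; exists i0.
have mstr j x := measurable_straight R d j x i0.
have mS m x := measurable_survival R d m x.
elim: k => [|k IH] j x.
  (* For k = 0 the survival factor is bounded by 1, leaving the mean p^j of the straight path. *)
  rewrite expr0 subrr mul0r add0r mul1r !addn0 -(integral_straight R d p P j x i0 hP).
  apply: ge0_le_integral => //.
  - by move=> w _; rewrite lee_fin mulr_ge0 ?straight_ge0 ?survival_ge0.
  - exact/measurable_EFinP/measurable_funM.
  - exact/measurable_EFinP.
  - move=> w _; rewrite lee_fin ler_piMr ?straight_ge0 //.
    by rewrite -[n]add0n (survival_nonincreasing R d 0 n).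
(* [f i] is the contribution of the walks whose next step is in direction [i]. *)
pose f i w : R := straight R d j w x i0 *
  ((w (edge_at d (translate d x i0 j) i))%:R *
   survival R d (n + k) w (neighbor d (translate d x i0 j) i)).
have f0 i w : 0 <= f i w.
  by rewrite !mulr_ge0 ?straight_ge0 ?survival_ge0.
have mf i : measurable_fun setT (f i).
  by apply: measurable_funM => //; apply: measurable_funM => //; exact: measurable_kept.
have -> : (\int[P]_w (straight R d j w x i0 * survival R d (n + k.+1) w (translate d x i0 j))%:E
  = q%:E * \sum_i \int[P]_w (f i w)%:E)%E.
  rewrite -ge0_integral_sum //; last first.
  - by move=> i w _; rewrite lee_fin.
  - by move=> i; exact/measurable_EFinP.
  rewrite -ge0_integralZl //; first last.
  - by rewrite lee_fin invr_ge0.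
  - by move=> w _; apply: sume_ge0 => i _; rewrite lee_fin.
  - by apply: emeasurable_sum => i; exact/measurable_EFinP.
  apply: eq_integral => w _; rewrite sumEFin -EFinM; congr (_%:E).
  by rewrite addnS survivalS mulrCA mulr_sumr.
rewrite (bigD1 i0) //=.
(* A step along [i0] lengthens the straight path to j+1, with k steps to go. *)
have le0 : (\int[P]_w (f i0 w)%:E <=
    ((1 - q ^+ k) * c + q ^+ k * p ^+ (j + k.+1))%:E)%E.
  rewrite -addSnnS; apply: le_trans (IH j.+1 x).
  rewrite le_eqVlt; apply/orP; left; apply/eqP.
  apply: eq_integral => w _; congr (_%:E).
  by rewrite /f /straight big_ord_recr /= translateS mulrA.
(* In each of the other 2d-1 directions, the path, the new edge and the last k steps are dropped; n
   steps from the neighbor remain, with mean at most [c]. *)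
have le1 : (\sum_(i | i != i0) \int[P]_w (f i w)%:E <= ((#|{: direction d}|%:R - 1) * c)%:E)%E.
  apply: (@le_trans _ _ (\sum_(i | i != i0) c%:E)%E).
    apply: lee_sum => i _; apply: le_trans (Sc (neighbor d (translate d x i0 j) i)).
    apply: ge0_le_integral => //.
    - by move=> w _; rewrite lee_fin.
    - exact/measurable_EFinP.
    - exact/measurable_EFinP.
    - move=> w _; rewrite lee_fin.
      apply: le_trans (survival_nonincreasing R d n k _ _).
      rewrite /f mulrA ler_piMl ?survival_ge0 //.
      by apply: mulr_ile1; rewrite ?straight_ge0 ?straight_le1 //; case: (w _).
  rewrite sumEFin lee_fin sumr_const cardC1 -subn1 -[leLHS]mulr_natl natrB //.
  by apply/card_gt0P; exists i0.
apply: (@le_trans _ _ (q%:E * (((1 - q ^+ k) * c + q ^+ k * p ^+ (j + k.+1))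
    + ((#|{: direction d}|%:R - 1) * c))%:E)%E).
  apply: lee_wpmul2l; first by rewrite lee_fin invr_ge0.
  by rewrite EFinD; exact: leeD.
rewrite -EFinM lee_fin le_eqVlt; apply/orP; left; apply/eqP.
have qN : q * #|{: direction d}|%:R = 1 by rewrite mulVf.
(* Used with a = q^k and b = p^(j+k+1); since q is the inverse of 2d, the result is the bound for
   k+1. *)
have E (a b : R) : q * ((1 - a) * c + a * b + (#|{: direction d}|%:R - 1) * c) =
    (q * #|{: direction d}|%:R - q * a) * c + q * a * b by ring.
by rewrite E qN exprS.
Qed.

(** * Uniform decay of the mean survival and the almost sure conclusion *)

Lemma exists_expr_lt (R : realType) (z e : R) :
  0 <= z < 1 -> 0 < e -> exists n, z ^+ n < e.
Proof.
move=> /andP[z0 z1] e0.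
have /cvg_expr/cvgr0_norm_lt /(_ _ e0) [n _ /(_ n (leqnn n))] : `|z| < 1.
  by rewrite ger0_norm.
by rewrite /= ger0_norm ?exprn_ge0 //; exists n.
Qed.

Lemma integral_survival_small (R : realType) d (p : R)
    (P : probability (config d) R) (e : R) :
  (0 < d)%N -> 0 <= p < 1 -> bernoulli_percolation p P -> 0 < e ->
  exists n, forall x, (\int[P]_w (survival R d n w x)%:E <= e%:E)%E.
Proof.
move=> d0 p01 hP e0.
have [k pk] := exists_expr_lt R p (e / 2) p01 (divr_gt0 e0 (ltr0Sn R 1)).
set r := 1 - #|{: direction d}|%:R^-1 ^+ k : R.
have N1 : 1 <= #|{: direction d}|%:R :> R by rewrite ler1n direction_gt0.
have N0 : 0 < #|{: direction d}|%:R :> R by exact: lt_le_trans N1.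
have r01 : 0 <= r < 1.
  rewrite subr_ge0 ltrBlDr ltrDl exprn_gt0 ?invr_gt0 // andbT.
  by apply: exprn_ile1; rewrite ?invr_ge0 ?ler0n // invf_le1.
have [m rm] := exists_expr_lt R r (e / 2) r01 (divr_gt0 e0 (ltr0Sn R 1)).
(* Lengthening the walk by k turns a uniform bound c into r c + (1 - r) p^k. This map fixes p^k and
   contracts by r, so from the bound 1 + p^k it reaches p^k + r^m after m rounds. *)
suff [n Sn] : exists n, forall x,
    (\int[P]_w (survival R d n w x)%:E <= (p ^+ k + r ^+ m)%:E)%E.
  exists n => x; apply: le_trans (Sn x) _; rewrite lee_fin; lra.
elim: m {rm} => [|m [n Sn]].
  exists 0 => x /=; apply: (@le_trans _ _ 1%E).
    rewrite integral_cst // mul1e; exact: probability_le1.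
  by rewrite lee_fin expr0 lerDr exprn_ge0 //; case/andP: p01.
exists (n + k)%N => x.
(* With j = 0 the straight path is empty, and the bound concerns S_(n+k)(x) itself. *)
have := integral_straight_survival R d p P (Ordinal d0, true) n _ hP Sn k 0 x.
under eq_integral do rewrite /straight big_ord0 mul1r /translate mulr0n addr0.
move=> /le_trans; apply; rewrite lee_fin add0n exprS /r; lra.
Qed.

(** Markov's inequality: on the exceptional event [B] every S_n(x) is at least [e], so e P(B) is at
    most E S_n(x), which is arbitrarily small. *)
Lemma ae_survival_small (R : realType) d (p : R)
    (P : probability (config d) R) (x : lattice d) (e : R) :
  (0 < d)%N -> 0 <= p < 1 -> bernoulli_percolation p P -> 0 < e ->
  {ae P, forall w, exists n, survival R d n w x < e}.
Proof.
move=> d0 p01 hP e0.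
pose B := \bigcap_n [set w : config d | e <= survival R d n w x].
have mB : measurable B.
  apply: bigcapT_measurable => n.
  rewrite (_ : [set w | _] =
      setT `&` (fun w : config d => survival R d n w x) @^-1` `[e, +oo[%classic).
    exact: measurable_survival.
  by apply/seteqP; split=> w /=; rewrite in_itv /= andbT // => -[].
exists B; split => //; last first.
  by move=> w /= /forallNP h n _; rewrite /= leNgt; apply/negP/h.
apply/eqP; rewrite eq_le measure_ge0 andbT -(@pmule_rle0 _ e%:E) ?lte_fin //.
apply/lee_addgt0Pr => c c0; rewrite add0e.
have [n /(_ x) Sn] := integral_survival_small R d p P c d0 p01 hP c0.
apply: le_trans Sn; rewrite -[B]setIT -integral_indic // -ge0_integralZl //; first last.
- by rewrite lee_fin ltW.
- exact/measurable_EFinP/measurable_indic.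
apply: ge0_le_integral => //.
- by move=> w _; rewrite -EFinM lee_fin mulr_ge0 // ltW.
- by apply: emeasurable_funM => //; exact/measurable_EFinP/measurable_indic.
- by apply/measurable_EFinP; exact: measurable_survival.
- move=> w _; rewrite -EFinM lee_fin indicE.
  case: (boolP (w \in B)) => [|_]; last by rewrite mulr0 survival_ge0.
  by rewrite inE mulr1 => /(_ n I).
Qed.

Theorem theorem32 (R : realType) (d : nat) (hd : (2 <= d)%N)
    (p : R) (hp0 : 0 < p) (hp1 : p < 1) (hpc : critical_parameter R d < p)
    (P : probability (config d) R) (hP : bernoulli_percolation p P) :
  {ae P, forall w : config d, forall u : lattice d -> R,
     bounded_fun u -> cluster_harmonic w u -> forall x : lattice d, u x = 0}.
Proof.
have d0 : (0 < d)%N by exact: ltnW.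
have p01 : 0 <= p < 1 by rewrite ltW.
(* Vertices are coded by natural numbers and thresholds are 1/(k+1), so that only countably many
   null sets are united. *)
have small : {ae P, forall w : config d, forall m k : nat,
    oapp (fun x : lattice d => exists n, survival R d n w x < k.+1%:R^-1) True (choice.unpickle m)}.
  apply: ae_foralln => m; apply: ae_foralln => k.
  case: (choice.unpickle m) => [x|] /=; last exact: aeW.
  by apply: ae_survival_small hP _.
apply: filterS small => w {}small u [M [_ uM]] uh x.
(* [bounded_fun] supplies every bound above [M]; this one is also positive. *)
have {}uM y : `|u y| <= `|M| + 1.
  by apply: uM => //; rewrite (le_lt_trans (ler_norm M)) // ltrDl.
apply/eqP; rewrite -normr_le0; apply/ler_addgt0Pr => e e0; rewrite add0r.
have M0 : 0 < `|M| + 1 by rewrite ltr_pwDr.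
have [k kM] : exists k, k.+1%:R^-1 < e / (`|M| + 1).
  have eM : 0 < e / (`|M| + 1) by exact: divr_gt0.
  have [k _ /(_ k (leqnn k)) kM] := near_infty_natSinv_lt (PosNum eM).
  by exists k.
have := small (choice.pickle x) k; rewrite choice.pickleK /= => -[n Sn].
apply: le_trans (harmonic_le_survival _ _ _ _ _ d0 uh uM n x) _.
rewrite -ler_pdivlMl // mulrC; exact: ltW (lt_trans Sn kM).
Qed.
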